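(* Let $K$ be a quasi-algebraically closed field. Let $e \geq 3$ be an integer and let $V$ be a finite-dimensional vector space over $K$ with $\dim V \geq e+1$. Then every alternating $e$-form $\omega$ on $V$ has an $\omega$-singular $(e-1)$-dimensional subspace, i.e. there is an $(e-1)$-dimensional subspace $U \subseteq V$ with $\omega(u_1,\ldots,u_{e-1},v)=0$ for all $u_1,\ldots,u_{e-1}\in U$ and all $v \in V$.
   Context: A field $K$ is quasi-algebraically closed if every non-constant homogeneous polynomial over $K$ whose degree is strictly less than its number of variables has a non-zero root in $K^{\text{(number of variables)}}$ (e.g. every finite field, by Chevalley–Warning). An alternating $e$-form on $V$ is an alternating multilinear map $V^e \to K$. For $d \leq e$, a $d$-dimensional subspace $U$ of $V$ is called $\omega$-singular if $\omega(u_1,\ldots,u_d,v_{d+1},\ldots,v_e)=0$ for all $u_1,\ldots,u_d \in U$ and all $v_{d+1},\ldots,v_e \in V$. *)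

(* Defs.v *)
From HB Require Import structures.
From mathcomp Require Import all_boot all_order all_algebra.
Set Implicit Arguments. Unset Strict Implicit. Unset Printing Implicit Defensive.
Import GRing.Theory.
Local Open Scope ring_scope.

(* A homogeneous polynomial of degree d in n variables over K is given by its
   coefficients c m, indexed by exponent vectors m : {ffun 'I_n -> 'I_d.+1};
   only the monomials with total degree (\sum_i m i) = d count. *)
Definition hmonomial (n d : nat) (m : {ffun 'I_n -> 'I_d.+1}) : bool :=
  (\sum_(i < n) (m i : nat))%N == d.

Definition heval (K : fieldType) (n d : nat)
  (c : {ffun 'I_n -> 'I_d.+1} -> K) (x : 'I_n -> K) : K :=
  \sum_(m | hmonomial m) c m * \prod_(i < n) x i ^+ m i.

Definition quasi_alg_closed (K : fieldType) : Prop :=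
  forall (n d : nat) (c : {ffun 'I_n -> 'I_d.+1} -> K),
    (0 < d)%N -> (d < n)%N ->
    (exists m, hmonomial m && (c m != 0)) ->
    exists x : 'I_n -> K, (exists i, x i != 0) /\ heval c x = 0.

Definition upd (V : Type) (e : nat) (w : {ffun 'I_e -> V}) (i : 'I_e) (x : V)
  : {ffun 'I_e -> V} := [ffun j => if j == i then x else w j].

Definition multilinear (K : fieldType) (V : vectType K) (e : nat)
  (om : {ffun 'I_e -> V} -> K) : Prop :=
  forall (w : {ffun 'I_e -> V}) (i : 'I_e) (a : K) (x y : V),
    om (upd w i (a *: x + y)) = a * om (upd w i x) + om (upd w i y).

Definition alternating_form (K : fieldType) (V : vectType K) (e : nat)
  (om : {ffun 'I_e -> V} -> K) : Prop :=
  multilinear om /\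
  forall (w : {ffun 'I_e -> V}) (i j : 'I_e), i != j -> w i = w j -> om w = 0.

(* U (of dimension d <= e) is om-singular: om(u_1,..,u_d,v_{d+1},..,v_e) = 0
   for all u_k in U and all v_k in V. *)
Definition singular (K : fieldType) (V : vectType K) (e : nat)
  (om : {ffun 'I_e -> V} -> K) (U : {vspace V}) : Prop :=
  forall w : {ffun 'I_e -> V},
    (forall i : 'I_e, (i < \dim U)%N -> w i \in U) -> om w = 0.

(* Main.v *)
Require Import Defs.
From HB Require Import structures.
From mathcomp Require Import all_boot all_order all_algebra all_fingroup zify.
From mathcomp Require Import mpoly.
Set Implicit Arguments. Unset Strict Implicit. Unset Printing Implicit Defensive.
Import GRing.Theory.
Local Open Scope ring_scope.

(* Contracting with e - 3 independent vectors reduces the claim to a trilinear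
   form T on a space of dimension n >= 4. Let A(x) be the matrix of T(x, -, -)
   over K[x_1, .., x_n]: x lies in its left and right kernels, so the diagonal
   entries of its adjugate satisfy x_k^2 adj_ii = x_i^2 adj_kk. Hence
   adj_ii = g x_i^2 with a single g, which is homogeneous of degree
   (n - 1) - 2 < n. At a nonzero root x of g, with x_i <> 0, the (i, i) minor of
   A(x) vanishes, which yields y with y_i = 0, y <> 0 and A(x) y = 0: the vectors
   x, y are independent and T(x, y, -) = 0. (For n odd, g = f^2 where the sub-Pfaffians
   of A are +- x_i f; working with g avoids Pfaffians and the parity of n.) *)

(** * Adjugates of singular matrices *)

Lemma det_kernel (R : idomainType) (n : nat) (A : 'M[R]_n) (x : 'cV[R]_n) :
  x != 0 -> A *m x = 0 -> \det A = 0.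
Proof.
move=> /cV0Pn [i xi_neq0] Ax0; have := mul_adj_mx A => /(congr1 (mulmx^~ x)).
rewrite /= -mulmxA Ax0 mulmx0 mul_scalar_mx => /matrixP/(_ i 0)/esym/eqP.
by rewrite !mxE mulf_eq0 (negPf xi_neq0) orbF => /eqP.
Qed.

Lemma det_replace_row (R : comPzRingType) (n : nat) (A : 'M[R]_n) (j : 'I_n)
  (r : 'rV[R]_n) :
  \det (\matrix_(a, c) if a == j then r 0 c else A a c)
    = \sum_c r 0 c * \adj A c j.
Proof.
rewrite (expand_det_row _ j); apply: eq_bigr => c _.
rewrite !mxE eqxx; congr (_ * _); rewrite /cofactor; congr (_ * \det _).
by apply/matrixP => a d; rewrite !mxE eq_sym (negPf (neq_lift _ _)).
Qed.

(* Replacing row [j] of [A] by a row orthogonal to [x] keeps [x] in the kernel. *)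
Lemma adj_kernel (R : idomainType) (n : nat) (A : 'M[R]_n) (x : 'cV[R]_n)
  (i j k : 'I_n) :
  x != 0 -> A *m x = 0 -> x k 0 * \adj A i j = x i 0 * \adj A k j.
Proof.
move=> x_neq0 Ax0; apply/eqP; rewrite -subr_eq0; apply/eqP.
pose r : 'rV[R]_n := x k 0 *: delta_mx 0 i - x i 0 *: delta_mx 0 k.
have delta_sum (F : 'I_n -> R) l :
    \sum_c (delta_mx 0 l : 'rV[R]_n) 0 c * F c = F l.
  rewrite (bigD1 l) //= mxE !eqxx mul1r big1 ?addr0 // => c /negPf c_l.
  by rewrite mxE c_l mul0r.
have r_sum (F : 'I_n -> R) :
    \sum_c r 0 c * F c = x k 0 * F i - x i 0 * F k.
  rewrite -(delta_sum F i) -(delta_sum F k) !mulr_sumr -sumrB.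
  by apply: eq_bigr => c _; rewrite !mxE mulrBl !mulrA.
rewrite -(r_sum (fun c => \adj A c j)) -det_replace_row.
apply: (det_kernel x_neq0); apply/matrixP => a b; rewrite (ord1 b) !mxE.
have [->|a_j] := eqVneq a j.
  under eq_bigr => c _ do rewrite mxE eqxx.
  by rewrite (r_sum (fun c => x c 0)) mulrC subrr.
move/matrixP/(_ a 0): Ax0; rewrite !mxE => Ax0; rewrite -[RHS]Ax0.
by apply: eq_bigr => c _; rewrite !mxE (negPf a_j).
Qed.

(** The kernel relation for [A] exchanges row indices of the adjugate, the one for [A^T] column
    indices; moving from [(i, i)] to [(k, k)] uses each once, which produces the squares. *)
Lemma adj_kernel2 (R : idomainType) (n : nat) (A : 'M[R]_n) (x : 'cV[R]_n)
  (i k : 'I_n) :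
  x != 0 -> A *m x = 0 -> x^T *m A = 0 ->
  x k 0 ^+ 2 * \adj A i i = x i 0 ^+ 2 * \adj A k k.
Proof.
move=> x_neq0 Ax0 xA0; rewrite !expr2 -!mulrA (adj_kernel i i k x_neq0 Ax0).
have ATx0 : A^T *m x = 0 by rewrite -[x]trmxK -trmx_mul xA0 trmx0.
have:= adj_kernel i k k x_neq0 ATx0.
by rewrite -trmx_adj ![_^T _ _]mxE mulrCA => ->.
Qed.

(** * Homogeneous polynomials and their roots *)

Lemma det_homog (R : comNzRingType) (n m : nat) (M : 'M[{mpoly R[n]}]_m) :
  (forall i j, M i j \is 1.-homog) -> \det M \is m.-homog.
Proof.
move=> homM; apply: rpred_sum => s _.
rewrite -signr_odd; set P := \prod_(i < m) _.
have homP : P \is m.-homog.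
  (* The degree [m] is rewritten as a sum of [m] ones, so that one induction runs over the product
     and its degree together. *)
  rewrite {}/P -[X in X.-homog]subn0 -[m in (m - 0)%N]card_ord -sum1_card subn0.
  apply: (big_rec2 (fun p d => p \is d.-homog)); first exact: dhomog1.
  by move=> i d p _ homp; apply: dhomogM.
by case: (odd _); rewrite ?expr1 ?expr0 ?mulN1r ?mul1r // rpredN.
Qed.

Lemma mpolyX_neq0 (R : nzRingType) (n : nat) (m : 'X_{1..n}) :
  'X_[m] != 0 :> {mpoly R[n]}.
Proof. by rewrite -msize_poly_eq0 msizeX. Qed.

Lemma mcoeffMX_neq0 (R : nzRingType) (n : nat) (p : {mpoly R[n]})
  (b m : 'X_{1..n}) : (p * 'X_[b])@_m != 0 -> (b <= m)%MM.
Proof.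
rewrite -mcoeff_msupp => /msuppM_le /allpairsP [[k l] /= [_]].
by rewrite msuppX inE => /eqP -> ->; rewrite lem_addl.
Qed.

(** Coprimality of ['X_i ^+ 2] and ['X_j ^+ 2], read on monomials: for [m] in the support of [p],
    ['X_i ^+ 2] divides ['X_[m] * 'X_j ^+ 2], hence ['X_[m]]. The quotient is then formed term by
    term. *)
Lemma mpoly_div_homog (R : idomainType) (n d : nat) (p q : {mpoly R[n]})
  (i j : 'I_n) :
  i != j -> p \is d.+2.-homog -> p * 'X_j ^+ 2 = q * 'X_i ^+ 2 ->
  exists2 g : {mpoly R[n]}, g \is d.-homog & p = g * 'X_i ^+ 2.
Proof.
move=> i_j homp; rewrite !mpolyXn => Epq.
have supp m : m \in msupp p -> ((U_(i) *+ 2)%MM <= m)%MM.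
  rewrite mcoeff_msupp -(mcoeffMX p (U_(j) *+ 2)%MM) Epq => /mcoeffMX_neq0.
  move=> /mnm_lepP le_m; apply/mnm_lepP => l; have := le_m l.
  rewrite mnmDE !mulmnE !mnm1E.
  by have [<-|] := eqVneq i l; rewrite ?[j == _]eq_sym ?(negPf i_j) ?mul0n ?addn0.
exists (\sum_(m <- msupp p) p@_m *: 'X_[m - U_(i) *+ 2]).
  rewrite big_seq; apply: rpred_sum => m m_p; apply: rpredZ.
  rewrite dhomogX /=; have := dhomog_mf homp m_p => /=.
  by rewrite -{1}(submK (supp m m_p)) mdegD mdegMn mdeg1 mul1n addn2 => -[->].
rewrite [LHS]mpolyE mulr_suml !big_seq; apply: eq_bigr => m m_p.
by rewrite -scalerAl -mpolyXD submK ?supp.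
Qed.

Lemma qac_homog_root (K : fieldType) (n d : nat) (g : {mpoly K[n]}) :
  quasi_alg_closed K -> (0 < d < n)%N -> g \is d.-homog ->
  exists2 x : 'I_n -> K, exists i, x i != 0 & g.@[x] = 0.
Proof.
move=> HK /andP [d_gt0 d_ltn] homg.
have [->|g_neq0] := eqVneq g 0.
  exists (fun=> 1); last by rewrite meval0.
  by exists (Ordinal (leq_trans (ltn0Sn _) d_ltn)); rewrite oner_eq0.
pose mn (m : {ffun 'I_n -> 'I_d.+1}) : 'X_{1..n} := [multinom (m i : nat) | i < n].
pose nm (m : 'X_{1..n}) : {ffun 'I_n -> 'I_d.+1} := [ffun i => inord (m i)].
have mn_deg m : mdeg (mn m) = (\sum_(i < n) (m i : nat))%N.
  by rewrite mdegE; apply: eq_bigr => i _; rewrite mnmE.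
have nmK m : mdeg m = d -> mn (nm m) = m.
  move=> deg_m; apply/mnmP => i; rewrite mnmE ffunE inordK // ltnS -deg_m mdegE.
  by rewrite (bigD1 i) //= leq_addr.
have mnK m : nm (mn m) = m.
  by apply/ffunP => i; rewrite ffunE mnmE inord_val.
have [|x [x_neq0 gx0]] := HK n d (fun m => g@_(mn m)) d_gt0 d_ltn.
  exists (nm (mlead g)); have deg_g := dhomog_mf homg (mlead_supp g_neq0).
  by rewrite /hmonomial -mn_deg nmK // deg_g eqxx mleadc_eq0.
exists x => //; rewrite -{}gx0 mevalE /heval.
pose F (m : 'X_{1..n}) := g@_m * \prod_i x i ^+ m i.
pose r := [seq mn m | m <- index_enum _ & hmonomial m].
(* By homogeneity the support of [g] consists of the degree [d] monomials with nonzero coefficient;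
   the other monomials listed in [r] contribute zero. *)
transitivity (\sum_(m <- r | g@_m != 0) F m).
  rewrite -[RHS]big_filter; apply: perm_big; apply: uniq_perm.
  - exact: msupp_uniq.
  - rewrite filter_uniq // map_inj_uniq ?filter_uniq ?index_enum_uniq //.
    exact: can_inj mnK.
  move=> m; rewrite mem_filter -mcoeff_msupp; case m_g: (m \in msupp g) => //=.
  have deg_m := dhomog_mf homg m_g.
  apply/esym/mapP; exists (nm m); last by rewrite nmK.
  by rewrite mem_filter mem_index_enum andbT /hmonomial -mn_deg nmK // deg_m.
rewrite big_rmcond => [|m]; last by rewrite negbK /F => /eqP ->; rewrite mul0r.
rewrite big_map big_filter; apply: eq_bigr => m _; rewrite /F.
by congr (_ * _); apply: eq_bigr => i _; rewrite mnmE.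
Qed.

(** * The trilinear case *)

Lemma alternating_sum (R : zmodType) (n : nat) (c : 'I_n -> 'I_n -> R) :
  (forall k, c k k = 0) -> (forall k l, c k l = - c l k) ->
  \sum_k \sum_l c k l = 0.
Proof.
move=> c_diag c_anti.
(* The terms above the diagonal cancel those below. The diagonal is treated apart, since
   antisymmetry does not make it vanish in characteristic 2. *)
have -> : \sum_k \sum_l c k l
    = \sum_(k < n) \sum_(l < n | (k < l)%N) c k l
      + \sum_(k < n) \sum_(l < n | (l < k)%N) c k l.
  rewrite -big_split; apply: eq_bigr => k _ /=.
  rewrite (bigID (fun l : 'I_n => (k < l)%N)) /=; congr (_ + _).
  rewrite (bigD1 k) ?ltnn //= c_diag add0r; apply: eq_bigl => l.
  by rewrite -leqNgt ltn_neqAle andbC.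
rewrite [X in _ + X](exchange_big_dep xpredT) //= -big_split big1 // => k _ /=.
by rewrite -big_split big1 // => l _ /=; rewrite (c_anti k l) addNr.
Qed.

(** [T] holds the values of the form on basis vectors. The indices [i] and [j] certify that [x] and
    [y] are linearly independent. *)
Lemma alternating_trilinear_singular_pair (K : fieldType) (n : nat)
  (T : 'I_n -> 'I_n -> 'I_n -> K) :
  quasi_alg_closed K -> (3 < n)%N ->
  (forall k m, T k k m = 0) -> (forall k l m, T k l m = - T l k m) ->
  (forall k l, T k l k = 0) -> (forall k l m, T k l m = - T m l k) ->
  exists (x y : 'I_n -> K) (i j : 'I_n), [/\ x i != 0, y i = 0, y j != 0
    & forall m, \sum_k \sum_l x k * y l * T k l m = 0].
Proof.
move=> HK; case: n T => [|[|[|[|n]]]] // T _ T12 T12N T13 T13N.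
(* Rows carry the third argument of [T] and columns the second, so [A y = 0] says that
   [T(x, y, -) = 0]. The map [f] lets one definition cover both the generic matrix and its value at
   a point. *)
pose A (R : comPzRingType) (f : K -> R) (v : 'I_n.+4 -> R) : 'M[R]_n.+4 :=
  \matrix_(m, l) \sum_k f (T k l m) * v k.
have A_ker (R : comPzRingType) (f : {additive K -> R}) v :
    A R f v *m (\col_l v l) = 0.
  apply/matrixP => m j; rewrite !mxE.
  under eq_bigr => l _ do rewrite !mxE mulr_suml.
  apply: alternating_sum => [l|k l]; first by rewrite T12 raddf0 !mul0r.
  by rewrite T12N raddfN !mulNr -!mulrA [v l * _]mulrC.
have A_coker (R : comPzRingType) (f : {additive K -> R}) v :
    (\col_l v l)^T *m A R f v = 0.
  apply/matrixP => j l; rewrite !mxE.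
  under eq_bigr => m _ do rewrite !mxE mulr_sumr.
  apply: alternating_sum => [m|m k]; first by rewrite T13 raddf0 mul0r mulr0.
  by rewrite T13N raddfN mulNr mulrN ![v _ * _]mulrC -!mulrA [v m * _]mulrC.
pose AX := A _ (@mpolyC n.+4 K) (fun k => 'X_k).
pose X : 'cV[{mpoly K[n.+4]}]_n.+4 := \col_l 'X_l.
have X_neq0 : X != 0.
  by apply/cV0Pn; exists 0; rewrite mxE mpolyX_neq0.
have homAX i j : AX i j \is 1.-homog.
  rewrite mxE; apply: rpred_sum => k _; rewrite mul_mpolyC.
  by apply: rpredZ; rewrite dhomogX /= mdeg1.
pose i0 : 'I_n.+4 := 0; pose i1 : 'I_n.+4 := lift 0 0.
have adjAX i k : 'X_k ^+ 2 * \adj AX i i = 'X_i ^+ 2 * \adj AX k k.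
  have XE l : X l 0 = 'X_l by rewrite mxE.
  by rewrite -!XE; exact: (adj_kernel2 i k X_neq0 (A_ker _ _ _) (A_coker _ _ _)).
have [g homg adj00] : exists2 g : {mpoly K[n.+4]},
    g \is n.+1.-homog & \adj AX i0 i0 = g * 'X_i0 ^+ 2.
  (* The [(i0, i0)] minor has size [n.+3], so the quotient by a square has degree [n.+1]. *)
  apply: (@mpoly_div_homog _ _ _ _ (\adj AX i1 i1) i0 i1) => //.
    rewrite mxE /cofactor addnn -signr_odd odd_double mul1r.
    by apply: det_homog => i j; rewrite 2!mxE.
  by rewrite mulrC adjAX mulrC.
have adjii i : \adj AX i i = g * 'X_i ^+ 2.
  apply: (@mulfI _ ('X_i0 ^+ 2)); first by rewrite expf_neq0 // mpolyX_neq0.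
  by rewrite adjAX adj00 mulrCA mulrC -mulrA mulrC -mulrA.
have deg_range : (0 < n.+1 < n.+4)%N by rewrite /= !ltnS leqW.
have [x [i xi_neq0] gx0] := qac_homog_root HK deg_range homg.
pose Ax := A K idfun x.
have Ax_eval : map_mx (meval x) AX = Ax.
  apply/matrixP => m l; rewrite !mxE rmorph_sum; apply: eq_bigr => k _ /=.
  by rewrite mevalM mevalC mevalXU.
have adj_ii0 : \adj Ax i i = 0.
  by rewrite -Ax_eval -map_mx_adj mxE /= adjii mevalM gx0 mul0r.
(* With row [i] replaced by the unit row, the determinant is [\adj Ax i i = 0]. A kernel vector [v]
   of [B] then has [v_i = 0] and is killed by every row of [Ax] except possibly row [i]. *)
pose B := \matrix_(a, c) if a == i then (delta_mx 0 i : 'rV[K]_n.+4) 0 c else Ax a c.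
have detB0 : \det B^T = 0.
  rewrite det_tr det_replace_row (bigD1 i) //= adj_ii0 mulr0 add0r.
  by apply: big1 => c /negPf c_i; rewrite mxE c_i mul0r.
have /det0P [v /rV0Pn [j vj_neq0] vB0] : \det B^T == 0 by rewrite detB0.
have vi0 : v 0 i = 0.
  move/matrixP/(_ 0 i): vB0; rewrite !mxE (bigD1 i) //= !mxE !eqxx mulr1.
  by rewrite big1 ?addr0 // => c /negPf c_i; rewrite !mxE eqxx c_i mulr0.
pose w := Ax *m v^T.
have w0 m : m != i -> w m 0 = 0.
  move=> /negPf m_i; move/matrixP/(_ 0 m): vB0; rewrite !mxE => E; rewrite -[RHS]E.
  by apply: eq_bigr => c _; rewrite !mxE m_i mulrC.
(* Row [i] follows from the left kernel: [x^T w = 0] reduces to [x_i w_i = 0]. *)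
have wi0 : w i 0 = 0.
  have /matrixP/(_ 0 0) : (\col_l x l)^T *m w = 0 by rewrite mulmxA A_coker mul0mx.
  rewrite mxE [X in _ = X -> _]mxE (bigD1 i) //= big1 ?addr0 => [|m m_i]; last first.
    by rewrite w0 ?mulr0.
  rewrite [_^T _ _]mxE [X in X * _]mxE => /eqP.
  by rewrite mulf_eq0 (negPf xi_neq0) => /eqP.
exists x, (fun l => v 0 l), i, j; split=> // m.
have wm0 : w m 0 = 0 by have [->|/w0] := eqVneq m i.
rewrite -[RHS]wm0 exchange_big mxE; apply: eq_bigr => l _ /=.
rewrite !mxE mulr_suml; apply: eq_bigr => k _ /=.
by rewrite mulrC mulrA.
Qed.

(** * Multilinear and alternating forms *)

Lemma upd_id (V : Type) (e : nat) (w : {ffun 'I_e -> V}) i : upd w i (w i) = w.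
Proof. by apply/ffunP => j; rewrite ffunE; case: eqP => // ->. Qed.

Lemma updC (V : Type) (e : nat) (w : {ffun 'I_e -> V}) i j x y :
  i != j -> upd (upd w i x) j y = upd (upd w j y) i x.
Proof.
move=> i_j; apply/ffunP => k; rewrite !ffunE.
by have [->|//] := eqVneq k j; rewrite eq_sym (negPf i_j).
Qed.

Section AlternatingForm.
Variables (K : fieldType) (V : vectType K) (e : nat) (om : {ffun 'I_e -> V} -> K).

Lemma multilinear_updD w i x y : multilinear om ->
  om (upd w i (x + y)) = om (upd w i x) + om (upd w i y).
Proof. by move=> lin; rewrite -[x in x + y]scale1r lin mul1r. Qed.

Lemma multilinear_upd0 w i : multilinear om -> om (upd w i 0) = 0.
Proof.
move=> lin; apply: (addrI (om (upd w i 0))).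
by rewrite -multilinear_updD // !addr0.
Qed.

Lemma multilinear_upd_sum w i (I : finType) (a : I -> K) (v : I -> V) :
  multilinear om ->
  om (upd w i (\sum_j a j *: v j)) = \sum_j a j * om (upd w i (v j)).
Proof.
move=> lin; elim/big_rec2: _ => [|j r y _ <-]; first exact: multilinear_upd0.
exact: lin.
Qed.

(** The slots in [s] are expanded over the generators [X] one at a time, while the slots outside [s]
    stay fixed. *)
Lemma multilinear_span_eq0 (X : seq V) (s : seq 'I_e) (w : {ffun 'I_e -> V}) :
  multilinear om ->
  (forall w' : {ffun 'I_e -> V}, (forall i, i \notin s -> w' i = w i) ->
     (forall i, i \in s -> w' i \in X) -> om w' = 0) ->
  (forall i, i \in s -> w i \in <<X>>%VS) -> om w = 0.
Proof.
move=> lin; elim: s w => [|i s IHs] w om0 w_span; first exact: om0.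
have /coord_span wi : w i \in <<in_tuple X>>%VS by apply: w_span; rewrite mem_head.
rewrite -(upd_id w i) wi multilinear_upd_sum // big1 // => j _.
have Xj : X`_j \in X by rewrite mem_nth.
rewrite IHs ?mulr0 // => [w' w'_out w'_in|k k_s]; last first.
  by rewrite ffunE; case: eqP => _; [exact: memv_span|rewrite w_span // inE k_s orbT].
apply: om0 => k; rewrite inE; last first.
  case k_s: (k \in s); first by rewrite w'_in.
  by rewrite orbF => /eqP Ek; rewrite w'_out ?k_s // ffunE Ek eqxx.
by case/norP=> k_i k_s; rewrite w'_out // ffunE (negPf k_i).
Qed.

Hypothesis Hom : alternating_form om.

Lemma alternating_swap w i j x y : i != j ->
  om (upd (upd w i x) j y) = - om (upd (upd w i y) j x).
Proof.
move=> i_j; have [lin alt] := Hom; apply/eqP; rewrite -addr_eq0.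
have alt_ij u : om (upd (upd w i u) j u) = 0.
  by apply: (alt _ i j i_j); rewrite !ffunE !eqxx (negPf i_j).
have := alt_ij (x + y); rewrite multilinear_updD // !(updC _ _ _ i_j).
rewrite !multilinear_updD // -!(updC _ _ _ i_j) !alt_ij add0r addr0 addrC.
by move=> ->.
Qed.

Lemma alternating_perm_eq0 w (s : {perm 'I_e}) :
  om w = 0 -> om [ffun i => w (s i)] = 0.
Proof.
have [ts -> _] := prod_tpermP s.
elim: ts w => [|[i j] ts IHts] w om0.
  by rewrite big_nil -[RHS]om0; congr om; apply/ffunP => i; rewrite ffunE perm1.
rewrite big_cons.
have [->|i_j] := eqVneq i j; first by rewrite tperm1 mul1g; exact: IHts.
set t := (\prod_(_ <- _) _)%g; pose w' : {ffun 'I_e -> V} := [ffun k => w (t k)].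
have -> : [ffun k => w ((tperm i j * t)%g k)] = upd (upd w' i (w' j)) j (w' i).
  apply/ffunP => k; rewrite !ffunE permM.
  have [->|k_j] := eqVneq k j; first by rewrite tpermR.
  have [->|k_i] := eqVneq k i; first by rewrite tpermL.
  by rewrite tpermD // eq_sym.
by rewrite alternating_swap // upd_id upd_id IHts ?oppr0.
Qed.

(** Either [f] permutes the arguments, or it repeats one of them. *)
Lemma alternating_comp_eq0 w (f : 'I_e -> 'I_e) :
  om w = 0 -> om [ffun i => w (f i)] = 0.
Proof.
move=> om0; have [/injectiveP f_inj|] := boolP (injectiveb f).
  rewrite -[RHS](alternating_perm_eq0 (perm f_inj) om0); congr om.
  by apply/ffunP => i; rewrite !ffunE permE.
case/injectivePn => i [j i_j fij]; have [_ alt] := Hom.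
by apply: (alt _ i j i_j); rewrite !ffunE fij.
Qed.

End AlternatingForm.

(** * Free families obtained from part of a basis *)

Section FreeCompletion.
Variables (K : fieldType) (V : vectType K) (r n : nat) (b : (r + n).-tuple V).
Hypothesis b_free : free b.

Lemma coord_comb (x : 'I_n -> K) k :
  coord b (rshift r k) (\sum_l x l *: b`_(r + l)) = x k.
Proof.
rewrite linear_sum (bigD1 k) //= big1 ?addr0 => [|l l_k].
  by rewrite linearZ /= (coord_free (rshift r k)) // eqxx mulr1.
rewrite linearZ /= (coord_free (rshift r l)) // (inj_eq (@rshift_inj _ _)).
by rewrite (negPf l_k) mulr0.
Qed.

Lemma coord_span_take k v :
  v \in <<take r b>>%VS -> coord b (rshift r k) v = 0.
Proof.
move=> v_span; have := @coord_span _ _ _ (in_tuple (take r b)) v v_span => ->.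
rewrite linear_sum big1 // => i _; rewrite linearZ /=.
have i_r : (i < r)%N.
  by apply: leq_trans (ltn_ord i) _; rewrite size_take_min geq_minl.
rewrite nth_take // (coord_free (lshift n (Ordinal i_r))) //.
by rewrite eq_lrshift mulr0.
Qed.

(** The coordinates of index at least [r] vanish on [take r b]. In a relation expressing the [y]
    vector by the others, coordinate [r + i] kills the coefficient of the [x] vector, and coordinate
    [r + j] then contradicts [y j != 0]. *)
Lemma free_take_comb2 (x y : 'I_n -> K) i j :
  x i != 0 -> y i = 0 -> y j != 0 ->
  free (take r b ++ [:: \sum_k x k *: b`_(r + k); \sum_k y k *: b`_(r + k)]).
Proof.
move=> xi_neq0 yi0 yj_neq0; set xh := \sum_k _; set yh := \sum_k _.
have -> : free (take r b ++ [:: xh; yh]) = free [:: yh, xh & take r b].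
  by apply: perm_free; rewrite perm_catC /= (perm_catCA [:: xh] [:: yh]).
have b0_free : free (take r b).
  by move: b_free; rewrite -{1}(cat_take_drop r b) => /catl_free.
rewrite !free_cons b0_free andbT; apply/andP; split; last first.
  by apply: contra xi_neq0 => /(coord_span_take i); rewrite coord_comb => ->.
apply: contra yj_neq0; rewrite span_cons => /memv_addP [_ /vlineP [a ->]] [u u_span Ey].
have := congr1 (coord b (rshift r i)) Ey.
rewrite linearD linearZ /= !coord_comb (coord_span_take _ u_span) addr0 yi0.
move=> /esym/eqP; rewrite mulf_eq0 (negPf xi_neq0) orbF => /eqP a0.
have := congr1 (coord b (rshift r j)) Ey.
by rewrite a0 scale0r add0r coord_comb (coord_span_take _ u_span) => ->.
Qed.

End FreeCompletion.

(** * Reduction to the trilinear case *)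

Theorem mainTheorem1 (K : fieldType) (HK : quasi_alg_closed K)
  (V : vectType K) (e : nat) (He : (3 <= e)%N) (HV : (e.+1 <= \dim {:V})%N)
  (om : {ffun 'I_e -> V} -> K) (Hom : alternating_form om) :
  exists U : {vspace V}, \dim U = e.-1 /\ singular om U.
Proof.
case: e He HV om Hom => [|[|[|r]]] // _ HV om Hom; have [lin alt] := Hom.
pose n := (\dim {:V} - r)%N.
have n_gt3 : (3 < n)%N by rewrite /n; lia.
have dimV : \dim {:V} = (r + n)%N by rewrite /n; lia.
pose b := tcast dimV (vbasis {:V}).
have b_free : free b by rewrite val_tcast; exact: basis_free (vbasisP _).
have b_span v : v \in <<b>>%VS.
  by rewrite val_tcast (span_basis (vbasisP _)) memvf.
pose c (k : 'I_n) := b`_(r + k).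
have lt0 : (r < r.+3)%N by lia.
have lt1 : (r.+1 < r.+3)%N by lia.
pose i0 := Ordinal lt0; pose i1 := Ordinal lt1; pose i2 : 'I_r.+3 := ord_max.
have i01 : i0 != i1 by rewrite -val_eqE /=; lia.
have i02 : i0 != i2 by rewrite -val_eqE /=; lia.
have i12 : i1 != i2 by rewrite -val_eqE /=; lia.
(* The first [r = e - 3] slots are frozen at basis vectors and [fam] fills the last three. The
   variants below bring a chosen slot outermost, where linearity or a swap applies. *)
pose fb : {ffun 'I_r.+3 -> V} := [ffun i : 'I_r.+3 => b`_i].
pose fam x y z := upd (upd (upd fb i0 x) i1 y) i2 z.
have fam_yz_x x y z : fam x y z = upd (upd (upd fb i1 y) i2 z) i0 x.
  by rewrite /fam (updC _ _ _ i01) (updC _ _ _ i02).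
have fam_xz_y x y z : fam x y z = upd (upd (upd fb i0 x) i2 z) i1 y.
  by rewrite /fam (updC _ _ _ i12).
have fam_z_xy x y z : fam x y z = upd (upd (upd fb i2 z) i0 x) i1 y.
  by rewrite fam_xz_y (updC _ _ _ i02).
have fam_y_xz x y z : fam x y z = upd (upd (upd fb i1 y) i0 x) i2 z.
  by rewrite /fam (updC _ _ _ i01).
have fam0 x y z : fam x y z i0 = x.
  by rewrite fam_yz_x ffunE eqxx.
have fam1 x y z : fam x y z i1 = y.
  by rewrite fam_xz_y ffunE eqxx.
have fam2 x y z : fam x y z i2 = z by rewrite ffunE eqxx.
have fam_lt x y z (i : 'I_r.+3) : (i < r)%N -> fam x y z i = b`_i.
  move=> i_r; rewrite !ffunE -!val_eqE /=.
  by rewrite !ifN //; lia.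
pose T k l m := om (fam (c k) (c l) (c m)).
have [k m|k l m|k l|k l m|x [y [i [j [xi yi yj Txy]]]]] :=
  @alternating_trilinear_singular_pair K n T HK n_gt3.
- by apply: (alt _ i0 i1 i01); rewrite fam0 fam1.
- by rewrite /T !fam_z_xy alternating_swap.
- by apply: (alt _ i0 i2 i02); rewrite fam0 fam2.
- by rewrite /T !fam_y_xz alternating_swap.
pose xh := \sum_k x k *: c k; pose yh := \sum_k y k *: c k.
pose X := take r b ++ [:: xh; yh].
have X_free : free X by exact: free_take_comb2 xi yi yj.
have szr : size (take r b) = r by rewrite size_take size_tuple; case: ltnP => ?; lia.
have szX : size X = r.+2 by rewrite size_cat szr addn2.
exists <<X>>%VS; have dimX : \dim <<X>> = r.+2 by rewrite -szX; apply/eqP.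
split=> //= w w_X.
(* Expanding [z] in the basis: one of the first [r] vectors repeats a frozen slot, and any other is
   some [c m], covered by [Txy]. *)
have om_xy z : om (fam xh yh z) = 0.
  have /coord_span -> := b_span z.
  rewrite multilinear_upd_sum // big1 // => k _; rewrite -/(fam xh yh b`_k).
  suff -> : om (fam xh yh b`_k) = 0 by rewrite mulr0.
  have [k_r|r_k] := ltnP k r.
    have k_lt : (k < r.+3)%N by lia.
    apply: (alt _ (Ordinal k_lt) i2); first by rewrite -val_eqE /=; lia.
    by rewrite fam2 fam_lt.
  have m_lt : (k - r < n)%N by have := ltn_ord k; lia.
  rewrite -[RHS](Txy (Ordinal m_lt)) fam_yz_x multilinear_upd_sum //.
  apply: eq_bigr => k1 _; rewrite -fam_yz_x fam_xz_y multilinear_upd_sum //.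
  rewrite mulr_sumr; apply: eq_bigr => l _; rewrite -fam_xz_y mulrA.
  by rewrite /T /c /= subnKC.
pose s := [seq i : 'I_r.+3 <- enum 'I_r.+3 | (i < r.+2)%N].
have mem_s (k : 'I_r.+3) : (k \in s) = (k < r.+2)%N.
  by rewrite mem_filter mem_enum andbT.
apply: (@multilinear_span_eq0 _ _ _ om X s w lin) => [w' _ w'_X|k]; last first.
  by rewrite mem_s => k_lt; apply: w_X; rewrite dimX.
(* The first [e - 1] entries of [w'] now lie in the list [X], possibly with repetitions. Sending
   each slot to the position of its entry in [X] writes [w'] as [fam xh yh (w' i2)] composed with
   [f]. *)
pose f (k : 'I_r.+3) : 'I_r.+3 := if (k < r.+2)%N then inord (index (w' k) X) else k.
rewrite -[RHS](alternating_comp_eq0 Hom f (om_xy (w' i2))); congr om.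
apply/ffunP => k; rewrite ffunE /f; case: ifP => k_lt; last first.
  have -> : k = i2 by apply: val_inj => /=; have := ltn_ord k; lia.
  by rewrite fam2.
have w'k_X : w' k \in X by rewrite w'_X ?mem_s.
have idx_lt : (index (w' k) X < r.+2)%N by move: w'k_X; rewrite -index_mem szX.
rewrite -{1}(nth_index 0 w'k_X); set q := index _ _ in idx_lt *.
have q_val : (inord q : 'I_r.+3) = q :> nat by rewrite inordK //; lia.
rewrite nth_cat szr; case: ltnP => [q_r|r_q].
  by rewrite nth_take // fam_lt ?q_val.
have [q_r|q_r] : q = r \/ q = r.+1 by lia.
  have -> : inord q = i0 by apply: val_inj; rewrite /= q_val.
  by rewrite fam0 q_r subnn.
have -> : inord q = i1 by apply: val_inj; rewrite /= q_val.
by rewrite fam1 q_r subSnn.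
Qed.
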